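(* Let $u(t,x)$, $v(t,x)$, $t\in[0,T]$, $x\in\mathbb R$, be two continuous random fields, a.s. in $C^{0,1}(]0,T[\times\mathbb R)$, such that $v(t,x)=u(T-t,x)$. Then $v$ is a (weak) solution of the SPDE $$-\partial_tv(t,x)+\tfrac12\partial^2_{xx}v(t,x)+\dot\eta(x)\,\partial_xv(t,x)=\lambda(T-t,x),\qquad v(0,x)=u^0(x),$$ if and only if $u$ is a (weak) solution of the SPDE $$\partial_tu(t,x)+\tfrac12\partial^2_{xx}u(t,x)+\dot\eta(x)\,\partial_xu(t,x)=\lambda(t,x),\qquad u(T,x)=u^0(x).$$
   Context: $T>0$; $u^0:\mathbb R\to\mathbb R$ and $\lambda:[0,T]\times\mathbb R\to\mathbb R$ are continuous; $\eta=(\eta(x))_{x\in\mathbb R}$ is a continuous process and $\dot\eta$ its derivative in the sense of distributions. For a process $Y$ indexed by $\mathbb R$ with compact support a.s., $\int_{\mathbb R}d^\circ\eta(x)\,Y(x):=\lim_{\varepsilon\to0+}\int_{\mathbb R}Y(x)\frac{\eta(x+\varepsilon)-\eta(x-\varepsilon)}{2\varepsilon}dx$ (limit in probability). A continuous random field $v$, a.s. in $C^{0,1}(]0,T[\times\mathbb R)$, is a (weak) solution of the first SPDE if for every smooth compactly supported $\alpha$ and every $t\in[0,T]$ $$-\int_{\mathbb R}\alpha(x)v(t,x)dx+\int_{\mathbb R}\alpha(x)u^0(x)dx-\int_0^tds\,\frac12\int_{\mathbb R}\alpha'(x)\partial_xv(s,x)dx+\int_{\mathbb R}d^\circ\eta(x)\,\alpha(x)\Big(\int_0^t\partial_xv(s,x)ds\Big)=\int_0^tds\int_{\mathbb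 R}\alpha(x)\lambda(T-s,x)dx .$$ A continuous random field $u$, a.s. in $C^{0,1}(]0,T[\times\mathbb R)$, is a (weak) solution of the second SPDE if for every smooth compactly supported $\alpha$ and every $t\in[0,T]$ $$-\int_{\mathbb R}\alpha(x)u(t,x)dx+\int_{\mathbb R}\alpha(x)u^0(x)dx-\int_t^Tds\,\frac12\int_{\mathbb R}\alpha'(x)\partial_xu(s,x)dx+\int_{\mathbb R}d^\circ\eta(x)\,\alpha(x)\Big(\int_t^T\partial_xu(s,x)ds\Big)=\int_t^Tds\int_{\mathbb R}\alpha(x)\lambda(s,x)dx .$$ In both cases the existence of the symmetric integral is part of the requirement. *)

(* Defs.v *)
From HB Require Import structures.
From mathcomp Require Import all_boot all_order all_algebra.
From mathcomp Require Import all_classical all_reals all_analysis.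

Set Implicit Arguments.
Unset Strict Implicit.
Unset Printing Implicit Defensive.

Import Order.TTheory GRing.Theory Num.Theory.
Import numFieldNormedType.Exports.
Local Open Scope classical_set_scope.
Local Open Scope ring_scope.

Definition compactly_supported (R : realType) (f : R -> R) : Prop :=
  compact (closure [set x | f x != 0]).

Definition test_function (R : realType) (alpha : R -> R) : Prop :=
  (forall (n : nat) (x : R), derivable (alpha^`(n)%classic) x 1) /\
  compactly_supported alpha.

Definition dx (R : realType) (f : R -> R -> R) (t x : R) : R := (f t)^`()%classic x.

Definition continuous_on_time (R : realType) (I : set R) (f : R -> R -> R) :
    Prop :=
  {within I `*` [set: R], continuous (fun p : R * R => f p.1 p.2)}.

Definition C01 (R : realType) (I : set R) (f : R -> R -> R) : Prop :=
  [/\ continuous_on_time I f,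
      forall t x, I t -> derivable (f t) x 1 &
      continuous_on_time I (dx f)].

Section stochastic.
Context {d : measure_display} {Om : measurableType d} {R : realType}.
Variable P : probability Om R.

Definition sample_path (u : R -> R -> Om -> R) (w : Om) : R -> R -> R :=
  fun t x => u t x w.

(* A random field indexed by [0, T] x R is encoded by a total function whose
   values at times outside [0, T] are irrelevant. *)
Definition continuous_random_field (T : R) (u : R -> R -> Om -> R) : Prop :=
  (forall t x, t \in `[0, T] -> measurable_fun [set: Om] (u t x)) /\
  {ae P, forall w, continuous_on_time `[0, T] (sample_path u w)}.

Definition as_C01 (T : R) (u : R -> R -> Om -> R) : Prop :=
  {ae P, forall w, C01 `]0, T[ (sample_path u w)}.

Definition continuous_process (eta : R -> {RV P >-> R}) : Prop :=
  {ae P, forall w, continuous (fun x => eta x w)}.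

(* Convergence in probability as e -> 0+. The outer measure P^* agrees with P
   on measurable sets; it avoids evaluating P at a set that is only almost
   surely equal to an event. *)
Definition cvg_in_probability_at0 (X : R -> Om -> R) (L : Om -> R) : Prop :=
  forall a : R, 0 < a ->
    (P^*)%mu [set w | a <= `|X e w - L w|] @[e --> 0^'+] --> 0%E.

Definition symmetric_quotient (eta : R -> {RV P >-> R}) (e x : R) (w : Om) : R :=
  (eta (x + e) w - eta (x - e) w) / (2 * e).

(* The symmetric integral of Y against eta exists and equals L. *)
Definition is_symmetric_integral (eta : R -> {RV P >-> R}) (Y : R -> Om -> R)
    (L : {RV P >-> R}) : Prop :=
  [/\ {ae P, forall w, compactly_supported (Y ^~ w)},
      \forall e \near 0^'+, {ae P, forall w,
        lebesgue_measure.-integrable [set: R]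
          (fun x => (Y x w * symmetric_quotient eta e x w)%:E)} &
      cvg_in_probability_at0
        (fun e w => \int[lebesgue_measure]_x
          (Y x w * symmetric_quotient eta e x w)) L].

(* The weak formulation integrated over the times between a and b, with the
   field evaluated at time t. All time integrals are over the open interval, as
   dx u need not exist at the times 0 and T. The integrability clause says that
   the integrand \int_a^b dx u s x ds of the symmetric integral is well defined
   for every x, which regularity on the open strip does not guarantee; the
   other integrals exist because dx u can be moved onto alpha by parts. *)
Definition weak_identity (eta : R -> {RV P >-> R}) (g : R -> R -> R)
    (u0 : R -> R) (u : R -> R -> Om -> R) (alpha : R -> R) (t a b : R) : Prop :=
  {ae P, forall w, forall x,
    lebesgue_measure.-integrable `]a, b[ (fun s => (dx (sample_path u w) s x)%:E)} /\
  exists2 L : {RV P >-> R},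
    is_symmetric_integral eta
      (fun x w => alpha x *
         \int[lebesgue_measure]_(s in `]a, b[) dx (sample_path u w) s x) L &
    {ae P, forall w,
      - (\int[lebesgue_measure]_x (alpha x * u t x w))
      + \int[lebesgue_measure]_x (alpha x * u0 x)
      - \int[lebesgue_measure]_(s in `]a, b[)
          (2^-1 * \int[lebesgue_measure]_x
             (alpha^`()%classic x * dx (sample_path u w) s x))
      + L w
      = \int[lebesgue_measure]_(s in `]a, b[)
          \int[lebesgue_measure]_x (alpha x * g s x)}.

(* - d_t v + 1/2 d_xx v + eta' d_x v = g on [0, T], v(0, .) = u0. *)
Definition forward_weak_solution (T : R) (eta : R -> {RV P >-> R})
    (g : R -> R -> R) (u0 : R -> R) (v : R -> R -> Om -> R) : Prop :=
  [/\ continuous_random_field T v, as_C01 T v &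
      forall alpha t, test_function alpha -> t \in `[0, T] ->
        weak_identity eta g u0 v alpha t 0 t].

(* d_t u + 1/2 d_xx u + eta' d_x u = g on [0, T], u(T, .) = u0. *)
Definition backward_weak_solution (T : R) (eta : R -> {RV P >-> R})
    (g : R -> R -> R) (u0 : R -> R) (u : R -> R -> Om -> R) : Prop :=
  [/\ continuous_random_field T u, as_C01 T u &
      forall alpha t, test_function alpha -> t \in `[0, T] ->
        weak_identity eta g u0 u alpha t t T].

End stochastic.

(* Main.v *)
Require Import Defs.
From mathcomp Require Import all_boot all_order all_algebra.
From mathcomp Require Import all_classical all_reals all_analysis.
From mathcomp Require Import measurable_realfun lra.
Import Order.TTheory GRing.Theory Num.Theory.
Import numFieldNormedType.Exports.
Local Open Scope classical_set_scope.
Local Open Scope ring_scope.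

(** The equivalence is the change of variable s := T - s in the time integrals.
If v(t, .) = u(T - t, .) on [0, T], the spatial derivatives satisfy
dx v(s, .) = dx u(T - s, .), and reflecting ]a, b[ onto ]T - b, T - a[ turns
every term of the weak identity for v at time t into the term of the weak
identity for u at time T - t. With (a, b) = (0, t) this is the passage from the
backward to the forward equation; with (a, b) = (t, T) and u, v exchanged it is
the converse, so that a single lemma, [weak_identity_reflection], gives both
directions.

Two points need care.

The integrands of the time integrals, such as s |-> \int alpha' dx u(s, .), are
themselves defined by integrals, so that a change of variable for measurable
functions would first require a measurability argument in s. The reflection is
bijective and measurable both ways, hence transports simple functions to simple
functions; since the integral of a nonnegative function is a supremum over the
simple functions below it, the change of variable holds for arbitrary functions
([integral_measure_iso]).

The relation between u and v holds only almost surely, whereas the symmetric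
integral is a limit in probability taken with the outer measure. Sets that
agree off a null set have the same outer measure ([outer_measure_ae_eq]), so
the symmetric integral depends only on the almost sure class of its integrand,
and the same limit L serves for u and for v. *)

(** * Change of variable along an isomorphism of measure spaces *)

Section simple_functions.
Local Open Scope ereal_scope.
Import HBNNSimple.
Context {d1 d2 : measure_display} {X : measurableType d1}
  {Y : measurableType d2} {R : realType}.

Lemma nnsfun_comp (phi : X -> Y) (h : {nnsfun Y >-> R}) :
  measurable_fun [set: X] phi ->
  exists k : {nnsfun X >-> R}, (k : X -> R) = (h : Y -> R) \o phi.
Proof.
move=> mphi.
pose mcomp := isMeasurableFun.Build _ _ _ _ ((h : Y -> R) \o phi)
  (measurableT_comp (@measurable_funPT _ _ _ _ h) mphi).
have comp_fin : finite_set (range ((h : Y -> R) \o phi)).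
  by apply: sub_finite_set (@fimfunP _ _ h) => _ [x _ <-]; exists (phi x).
have comp_ge0 x : (0 <= ((h : Y -> R) \o phi) x)%R by exact: fun_ge0.
by exists (NonNegSimpleFun.Pack (NonNegSimpleFun.Class mcomp
  (FiniteImage.Build _ _ _ comp_fin) (isNonNegFun.Build _ _ _ comp_ge0))).
Qed.

(** Half of the change of variable for nonnegative functions: [h |-> h \o phi]
sends the simple functions below [f] to simple functions below [f \o phi] with
the same integral. The other half is this lemma for the inverse of [phi]. *)
Lemma sintegral_sup_le_comp (mu : {measure set X -> \bar R})
    (nu : {measure set Y -> \bar R}) (phi : X -> Y) (f : Y -> \bar R) :
    measurable_fun [set: X] phi ->
    (forall A, measurable A -> nu A = mu (phi @^-1` A)) ->
  ereal_sup [set sintegral nu h | h in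
    [set h : {nnsfun Y >-> R} | forall y, (h y)%:E <= f y]] <=
  ereal_sup [set sintegral mu h | h in
    [set h : {nnsfun X >-> R} | forall x, (h x)%:E <= f (phi x)]].
Proof.
move=> mphi numu; apply: ge_ereal_sup => _ [h hf <-].
have [k kh] := nnsfun_comp phi h mphi.
apply: ereal_sup_ubound; exists k; first by move=> x /=; rewrite kh; exact: hf.
by rewrite /sintegral; apply: eq_fsbigr => r _; rewrite kh numu.
Qed.

End simple_functions.

Section measure_isomorphism.
Local Open Scope ereal_scope.
Import HBNNSimple.
Context {d1 d2 : measure_display} {X : measurableType d1}
  {Y : measurableType d2} {R : realType}.

(** Valid for arbitrary [f] and [D]: as [phi] is bijective, the simple functions
below [f] correspond exactly to those below [f \o phi], so the two suprema that
define the integrals agree without approximating [f]. *)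
Lemma integral_measure_iso (mu : {measure set X -> \bar R})
    (nu : {measure set Y -> \bar R}) (phi : X -> Y) (psi : Y -> X)
    (D : set Y) (f : Y -> \bar R) :
    measurable_fun [set: X] phi -> measurable_fun [set: Y] psi ->
    cancel phi psi -> cancel psi phi ->
    (forall A, measurable A -> nu A = mu (phi @^-1` A)) ->
  \int[nu]_(y in D) f y = \int[mu]_(x in phi @^-1` D) f (phi x).
Proof.
move=> mphi mpsi phiK psiK numu.
have munu A : measurable A -> mu A = nu (psi @^-1` A).
  move=> mA; rewrite numu; last first.
    by rewrite -[X in measurable X]setTI; exact: mpsi.
  by congr (mu _); apply/seteqP; split => x /=; rewrite phiK.
have sup_eq (g : Y -> \bar R) :
    ereal_sup [set sintegral nu h | h in
      [set h : {nnsfun Y >-> R} | forall y, (h y)%:E <= g y]] =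
    ereal_sup [set sintegral mu h | h in
      [set h : {nnsfun X >-> R} | forall x, (h x)%:E <= g (phi x)]].
  apply/eqP; rewrite eq_le (sintegral_sup_le_comp mu nu phi g mphi numu)/=.
  rewrite (le_trans (sintegral_sup_le_comp nu mu psi (g \o phi) mpsi munu))//.
  rewrite le_eqVlt; apply/orP; left; apply/eqP.
  congr (ereal_sup [set _ | _ in _]).
  by apply/funext => h; apply: eq_forall => y /=; rewrite psiK.
have restrict_comp : (f \o phi) \_ (phi @^-1` D) = (f \_ D) \o phi.
  by apply/funext => x; rewrite /patch /=; congr (if _ then _ else _).
rewrite -/(f \o phi) /integral !sup_eq restrict_comp.
by rewrite funepos_comp funeneg_comp.
Qed.

End measure_isomorphism.

(** * Reflections of the real line *)

Section reflection.
Context {R : realType}.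
Implicit Types a b c : R.

Local Notation mu := (@lebesgue_measure R).

Lemma measurable_reflection c : measurable_fun [set: R] (fun s : R => c - s).
Proof. exact: measurable_funB. Qed.

Lemma preimage_reflection_itv c (b1 b2 : bool) a b :
  (fun s : R => c - s) @^-1` [set` Interval (BSide b1 a) (BSide b2 b)] =
  [set` Interval (BSide (~~ b2) (c - b)) (BSide (~~ b1) (c - a))].
Proof.
apply/seteqP; split => x /=; rewrite !in_itv/= => /andP[xa xb];
  by apply/andP; split; move: xa xb; case: b1; case: b2 => /=; lra.
Qed.

Lemma lebesgue_measure_reflection c (A : set R) : measurable A ->
  mu A = mu ((fun s : R => c - s) @^-1` A).
Proof.
move=> mA.
apply: (@lebesgue_measure_unique _ (pushforward mu
  ((fun s => c - s) : measurableTypeR R -> measurableTypeR R))) => //=.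
  exact: measurable_reflection.
move=> mr _ [[x y]/= _ <-].
rewrite /pushforward preimage_reflection_itv/= !lebesgue_measure_itv/= !lte_fin.
by rewrite ltrD2l ltrN2; case: ifP => // _; congr (_%:E); lra.
Qed.

Lemma integral_reflection c a b (f : R -> \bar R) :
  (\int[mu]_(s in `]a, b[) f (c - s)%R =
   \int[mu]_(s in `](c - b)%R, (c - a)%R[) f s)%E.
Proof.
have mr := measurable_reflection c.
rewrite [RHS](integral_measure_iso mu mu _ _ _ f mr mr (subKr c) (subKr c)).
  by rewrite preimage_reflection_itv/= !subKr.
exact: lebesgue_measure_reflection.
Qed.

Lemma Rintegral_reflection c a b (f : R -> R) :
  \int[mu]_(s in `]a, b[) f (c - s) = \int[mu]_(s in `]c - b, c - a[) f s.
Proof. by rewrite /Rintegral (integral_reflection c a b (EFin \o f)). Qed.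

Lemma integrable_reflection c a b (f : R -> \bar R) :
  mu.-integrable `]c - b, c - a[ f ->
  mu.-integrable `]a, b[ (fun s => f (c - s)).
Proof.
move=> /integrableP[mf intf]; apply/integrableP; split.
  apply: measurable_comp mf _ => //.
    move=> _ [s + <-]; rewrite /= !in_itv/= => /andP[sa sb].
    by apply/andP; split; lra.
  by apply: measurable_funTS; exact: measurable_reflection.
by rewrite (integral_reflection c a b (fun s => `|f s|%E)).
Qed.

End reflection.

(** * Almost sure modifications *)

Lemma outer_measure_ae_eq {d : measure_display} {X : measurableType d}
    {R : realType} (mu : {measure set X -> \bar R}) (A B : set X) :
  {ae mu, forall x, A x <-> B x} -> (mu^*)%mu A = (mu^*)%mu B.
Proof.
move=> [N [mN muN0 subN]].
have AB x : ~ N x -> A x <-> B x.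
  by move=> nNx; apply: contrapT => nAB; exact/nNx/subN.
have outerN0 : (mu^*)%mu N = 0%E := etrans (measurable_mu_extE mu mN) muN0.
have le_off_N (C D : set X) : (forall x, ~ N x -> C x -> D x) ->
    ((mu^*)%mu C <= (mu^*)%mu D)%E.
  move=> CD; apply: (@le_trans _ _ ((mu^*)%mu (D `|` N))).
    apply: le_mu_ext => x Cx; have [Nx|nNx] := pselect (N x); first by right.
    by left; exact: CD.
  by have := outer_measureU2 (mu_ext mu) D N; rewrite /= outerN0 adde0.
by apply/eqP; rewrite eq_le !le_off_N// => x /AB[].
Qed.

Section almost_sure_modification.
Context {d : measure_display} {Om : measurableType d} {R : realType}.
Variable P : probability Om R.

Lemma cvg_in_probability_at0_ae_eq (X Y : R -> Om -> R) (L : Om -> R) :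
  (forall e, {ae P, forall w, X e w = Y e w}) ->
  cvg_in_probability_at0 P X L -> cvg_in_probability_at0 P Y L.
Proof.
move=> XY XL a a0.
rewrite (_ : (fun e => _) =
    fun e => (P^*)%mu [set w | a <= `|X e w - L w|]); first exact: XL.
apply/funext => e; apply: outer_measure_ae_eq.
by apply: filterS (XY e) => w /= ->.
Qed.

Lemma is_symmetric_integral_ae_eq (eta : R -> {RV P >-> R})
    (Y Z : R -> Om -> R) (L : {RV P >-> R}) :
  {ae P, forall w x, Y x w = Z x w} ->
  is_symmetric_integral eta Y L -> is_symmetric_integral eta Z L.
Proof.
move=> YZ [csY intY cvgY].
have {}YZ : {ae P, forall w, Y ^~ w = Z ^~ w}.
  by apply: filterS YZ => w YZw; exact/funext.
split.
- by apply: filterS2 YZ csY => w <-.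
- apply: filterS intY => e; apply: filterS2 YZ => w YZw.
  by under [X in _ -> integrable _ _ X]eq_fun do
    rewrite -[Z _ w]/((Z ^~ w) _) -YZw.
- apply: cvg_in_probability_at0_ae_eq cvgY => e.
  apply: filterS YZ => w YZw.
  by apply: eq_Rintegral => x _; rewrite -[Z x w]/((Z ^~ w) x) -YZw.
Qed.

(** * Time reversal of the weak identity *)

(** Stated for a general time interval ]a, b[ and a general right-hand side so
that it can be applied both to (u, v) and to (v, u). *)
Lemma weak_identity_reflection (T : R) (eta : R -> {RV P >-> R})
    (g : R -> R -> R) (u0 : R -> R) (u v : R -> R -> Om -> R) (alpha : R -> R)
    (t a b : R) :
    {ae P, forall w t x, t \in `[0, T] -> v t x w = u (T - t) x w} ->
    t \in `[0, T] -> 0 <= a -> b <= T ->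
  weak_identity eta g u0 u alpha (T - t) (T - b) (T - a) ->
  weak_identity eta (fun s x => g (T - s) x) u0 v alpha t a b.
Proof.
move=> v_rev tT a0 bT [intu [L symL eqL]].
have dx_rev : {ae P, forall w s x, s \in `]a, b[ ->
    dx (sample_path v w) s x = dx (sample_path u w) (T - s) x}.
  apply: filterS v_rev => w vw s x sab.
  rewrite /dx; congr (_^`()%classic x); apply/funext => y; apply: vw.
  by move: sab; rewrite !in_itv/=; lra.
have int_rev : {ae P, forall w x,
    \int[lebesgue_measure]_(s in `]a, b[) dx (sample_path v w) s x =
    \int[lebesgue_measure]_(s in `]T - b, T - a[) dx (sample_path u w) s x}.
  apply: filterS dx_rev => w dxw x.
  rewrite -(Rintegral_reflection T a b (fun s => dx (sample_path u w) s x)).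
  by apply: eq_Rintegral => s; rewrite inE/= => sab; exact: dxw.
split.
  apply: filterS2 dx_rev intu => w dxw intw x.
  apply: eq_integrable (integrable_reflection _ _ _ _ (intw x)) => //.
  by move=> s; rewrite inE/= => sab; rewrite dxw.
exists L.
  apply: is_symmetric_integral_ae_eq symL.
  by apply: filterS int_rev => w intw x; rewrite intw.
apply: filterS3 v_rev dx_rev eqL => w vw dxw.
rewrite -[in X in X -> _](Rintegral_reflection T a b
  (fun s => \int[lebesgue_measure]_x (alpha x * g s x))) => <-.
rewrite -(Rintegral_reflection T a b (fun s => 2^-1 * \int[lebesgue_measure]_x
  (alpha^`()%classic x * dx (sample_path u w) s x))).
have field_rev : \int[lebesgue_measure]_x (alpha x * v t x w) =
    \int[lebesgue_measure]_x (alpha x * u (T - t) x w).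
  by apply: eq_Rintegral => x _; rewrite vw.
have space_rev s : s \in `]a, b[ ->
    \int[lebesgue_measure]_x
      (alpha^`()%classic x * dx (sample_path v w) s x) =
    \int[lebesgue_measure]_x
      (alpha^`()%classic x * dx (sample_path u w) (T - s) x).
  by move=> sab; apply: eq_Rintegral => x _; rewrite dxw.
have diffusion_rev : \int[lebesgue_measure]_(s in `]a, b[) (2^-1 *
      \int[lebesgue_measure]_x
        (alpha^`()%classic x * dx (sample_path v w) s x)) =
    \int[lebesgue_measure]_(s in `]a, b[) (2^-1 *
      \int[lebesgue_measure]_x
        (alpha^`()%classic x * dx (sample_path u w) (T - s) x)).
  apply: eq_Rintegral => s; rewrite inE/= => sab.
  exact: (congr1 (fun y => 2^-1 * y) (space_rev s sab)).
exact: (congr2 (fun x y => - x + \int[lebesgue_measure]_x (alpha x * u0 x)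
  - y + L w) field_rev diffusion_rev).
Qed.

End almost_sure_modification.

Theorem proposition9p1 (R : realType) (d : measure_display)
  (Om : measurableType d) (P : probability Om R) (T : R) (T_gt0 : 0 < T)
  (u0 : R -> R) (u0_cont : continuous u0)
  (lambda : R -> R -> R) (lambda_cont : continuous_on_time `[0, T] lambda)
  (eta : R -> {RV P >-> R}) (eta_cont : continuous_process eta)
  (u v : R -> R -> Om -> R)
  (u_cont : continuous_random_field P T u) (u_C01 : as_C01 P T u)
  (v_cont : continuous_random_field P T v) (v_C01 : as_C01 P T v)
  (v_rev : {ae P, forall w, forall t x, t \in `[0, T] ->
             v t x w = u (T - t) x w}) :
  forward_weak_solution T eta (fun t x => lambda (T - t) x) u0 v <->
  backward_weak_solution T eta lambda u0 u.
Proof.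
have rev_itv t : t \in `[0, T] -> T - t \in `[0, T].
  by rewrite !in_itv/=; lra.
have u_rev : {ae P, forall w t x, t \in `[0, T] -> u t x w = v (T - t) x w}.
  by apply: filterS v_rev => w vw t x /rev_itv tT; rewrite vw// subKr.
split=> [[_ _ weak_v]|[_ _ weak_u]].
- split; [exact: u_cont|exact: u_C01|move=> alpha t alpha_test tT].
  have /andP[t0 _] : 0 <= t <= T by move: tT; rewrite in_itv.
  (* lambda is the time reversal of the right-hand side of the forward SPDE. *)
  rewrite (_ : lambda = fun s x => lambda (T - (T - s)) x); last first.
    by apply/funext => s; rewrite subKr.
  apply: (weak_identity_reflection P T eta (fun s x => lambda (T - s) x) u0 v u
    alpha t t T u_rev tT t0 (lexx T)).
  by rewrite subrr; apply: weak_v => //; exact: rev_itv.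
- split; [exact: v_cont|exact: v_C01|move=> alpha t alpha_test tT].
  have /andP[_ tT'] : 0 <= t <= T by move: tT; rewrite in_itv.
  apply: (weak_identity_reflection P T eta lambda u0 u v alpha t 0 t v_rev tT
    (lexx 0) tT').
  by rewrite subr0; apply: weak_u => //; exact: rev_itv.
Qed.
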